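(* Every irrational matrix is NBA equivalent to a matrix of the form $$\begin{pmatrix}1&-\Delta\\1&-\widetilde\Delta\end{pmatrix},$$ where $\Delta>1$ and $-1<\widetilde\Delta<0$. Amidst the points of a lattice generated by such a matrix, the box $B_0=(-\Delta,1)\times(0,1-\widetilde\Delta)$ is a maximal empty axis-parallel box.
   Context: A lattice in $\mathbb{R}^2$ is $A\mathbb{Z}^2$ for an invertible real $2\times 2$ matrix $A$. A lattice is irrational if no two of its distinct points lie on the same horizontal or vertical line; a matrix is irrational if it generates an irrational lattice. Two invertible real $2\times2$ matrices are NBA (normalized box area) equivalent if one is obtained from the other by a finite sequence of the operations: multiplication from the left by a diagonal matrix $\mathrm{diag}(a,b)$ with $ab\ne0$; multiplication from the left by $\begin{pmatrix}0&1\\1&0\end{pmatrix}$; multiplication from the right by a matrix in $\mathrm{GL}_2(\mathbb{Z})$. An empty axis-parallel box is an open axis-parallel box containing no lattice point; it is maximal if it is not properly contained in another empty axis-parallel box. *)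

(* Defs.v *)
From Stdlib Require Import Relation_Operators.
From mathcomp Require Import all_boot all_order all_algebra.
From mathcomp Require Import classical_sets reals.
Set Implicit Arguments.
Unset Strict Implicit.
Unset Printing Implicit Defensive.
Import Order.TTheory GRing.Theory Num.Theory.
Local Open Scope classical_set_scope.
Local Open Scope ring_scope.

(* Points of the plane are column vectors: v 0 0 is the horizontal coordinate
   and v 1 0 the vertical one. *)

Definition mx2 (R : realType) (a b c d : R) : 'M[R]_2 :=
  \matrix_(i < 2, j < 2) (nth [::] [:: [:: a; b]; [:: c; d]] i)`_j.

Definition lattice_of (R : realType) (A : 'M[R]_2) : set 'cV[R]_2 :=
  [set v | exists z : 'cV[int]_2, v = A *m map_mx intr z].

Definition irrational_lattice (R : realType) (L : set 'cV[R]_2) : Prop :=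
  forall p q : 'cV[R]_2, L p -> L q -> p <> q ->
    p 0 0 <> q 0 0 /\ p 1 0 <> q 1 0.

Definition irrational_mx (R : realType) (A : 'M[R]_2) : Prop :=
  A \in unitmx /\ irrational_lattice (lattice_of A).

Inductive nba_step (R : realType) (A : 'M[R]_2) : 'M[R]_2 -> Prop :=
| NbaDiag (a b : R) of a * b != 0 : nba_step A (mx2 a 0 0 b *m A)
| NbaSwap : nba_step A (mx2 0 1 1 0 *m A)
| NbaGL2Z (U : 'M[int]_2) of U \in unitmx : nba_step A (A *m map_mx intr U).

(* No symmetric closure is needed: the inverse of each operation is an
   operation of the same kind. *)
Definition nba_equiv (R : realType) (A B : 'M[R]_2) : Prop :=
  [/\ A \in unitmx, B \in unitmx & clos_refl_trans _ (@nba_step R) A B].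

Definition open_box (R : realType) (a b c d : R) : set 'cV[R]_2 :=
  [set v | a < v 0 0 < b /\ c < v 1 0 < d].

Definition is_box (R : realType) (B : set 'cV[R]_2) : Prop :=
  exists a b c d : R, [/\ a < b, c < d & B = open_box a b c d].

Definition empty_box (R : realType) (L B : set 'cV[R]_2) : Prop :=
  is_box B /\ L `&` B = set0.

Definition maximal_empty_box (R : realType) (L B : set 'cV[R]_2) : Prop :=
  empty_box L B /\ forall B', empty_box L B' -> ~ (B `<` B').

(* Main.v *)
Require Import Defs.
From Stdlib Require Import Relation_Operators.
From mathcomp Require Import all_boot all_order all_algebra all_fingroup.
From mathcomp Require Import classical_sets reals.
From mathcomp Require Import ring lra.
Set Implicit Arguments.
Unset Strict Implicit.
Unset Printing Implicit Defensive.
Import Order.TTheory GRing.Theory Num.Theory.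
Local Open Scope ring_scope.

(** Normalizing the two coordinates of the first basis vector to 1 turns an
    irrational matrix into one with rows (1, s) and (1, t), where s and t are
    distinct irrational numbers ([irrational_mx_slopes]).  On the pair (s, t)
    the equivalence acts through exchanging s and t, the integral shifts
    (s + k, t + k), and the inversion (1/s, 1/t), which comes from exchanging
    the basis vectors and normalizing again.  The goal is to reach
    s < -1 and 0 < t < 1.

    The heart of the matter is to separate s and t by an integer.  If
    |s - t| >= 1 this is automatic.  Otherwise, shift by the integer nearest to
    the midpoint of s and t: then |st| <= 1/4, so that inversion multiplies the
    gap |s - t| by 1/|st| >= 4.  Hence finitely many shifts and inversions
    make the gap at least 1 ([reducible_gap]).

    Once s < k < t, shifting by -k gives s < 0 < t.  If s > -1, an inversion
    makes it smaller than -1 and keeps the signs.  Finally, subtracting the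
    floor of t puts t in (0, 1) and only decreases s ([reducible_neg_pos]).

    As for the box, a lattice point (m - D n, m - D' n) in it would satisfy
    m >= n if n >= 1 and m <= n if n <= 0 because of its first coordinate,
    and then its second coordinate is at least 1 - D', respectively at
    most 0 ([B0_empty]).  The box is maximal since each of its four open sides
    contains a lattice point ([B0_maximal]). *)

(** * Matrices of order two *)

Lemma mx2_mul (R : realType) (a b c d a' b' c' d' : R) :
  mx2 a b c d *m mx2 a' b' c' d' =
  mx2 (a * a' + b * c') (a * b' + b * d') (c * a' + d * c') (c * b' + d * d').
Proof.
apply/matrixP => i j; rewrite !mxE !big_ord_recl big_ord0 addr0 !mxE.
by case: i => [[|[|//]] ?]; case: j => [[|[|//]] ?].
Qed.

Lemma mx2_eta (R : realType) (A : 'M[R]_2) :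
  A = mx2 (A 0 0) (A 0 1) (A 1 0) (A 1 1).
Proof.
apply/matrixP => i j; rewrite !mxE.
by case: i => [[|[|//]] ?]; case: j => [[|[|//]] ?] /=;
  congr (A _ _); apply/val_inj.
Qed.

Lemma mx2_unit (R : realType) (a b c d : R) :
  (mx2 a b c d \in unitmx) = (a * d - b * c != 0).
Proof.
rewrite unitmxE unitfE (expand_det_row _ 0) !big_ord_recl big_ord0 addr0.
rewrite /cofactor !det_mx11 !mxE /=.
by rewrite expr0 expr1 mul1r mulN1r mulrN.
Qed.

(** * NBA equivalence of slope pairs *)

Lemma nba_mull_diag (R : realType) (u v : R) (A : 'M[R]_2) :
  A \in unitmx -> u * v != 0 -> nba_equiv A (mx2 u 0 0 v *m A).
Proof.
move=> Au uv; split=> //; last exact/rt_step/NbaDiag.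
by rewrite unitmx_mul Au mx2_unit mulr0 subr0 uv.
Qed.

Lemma slope_mx_unit (R : realType) (s t : R) :
  s != t -> mx2 1 s 1 t \in unitmx.
Proof. by rewrite mx2_unit mul1r mulr1 subr_eq0 eq_sym. Qed.

Lemma nba_swap_rows (R : realType) (s t : R) :
  s != t -> nba_equiv (mx2 1 s 1 t) (mx2 1 t 1 s).
Proof.
move=> st; split; rewrite ?slope_mx_unit // 1?eq_sym //.
have -> : mx2 1 t 1 s = mx2 0 1 1 0 *m mx2 1 s 1 t.
  by rewrite mx2_mul; congr mx2; ring.
exact/rt_step/NbaSwap.
Qed.

Lemma nba_mulr (R : realType) (A : 'M[R]_2) (U : 'M[int]_2) :
  A \in unitmx -> U \in unitmx -> nba_equiv A (A *m map_mx intr U).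
Proof.
move=> Au Uu; split=> //; last exact/rt_step/NbaGL2Z.
rewrite unitmx_mul Au /= unitmxE det_map_mx.
by apply: rmorph_unit; rewrite -unitmxE.
Qed.

Lemma nba_equiv_trans (R : realType) (B A C : 'M[R]_2) :
  nba_equiv A B -> nba_equiv B C -> nba_equiv A C.
Proof. by move=> [Au _ AB] [_ Cu BC]; split=> //; apply: rt_trans AB BC. Qed.

Lemma nba_slope_shift (R : realType) (k : int) (s t : R) :
  s != t -> nba_equiv (mx2 1 s 1 t) (mx2 1 (s + k%:~R) 1 (t + k%:~R)).
Proof.
move=> st; pose U : 'M[int]_2 := 1%:M + k *: delta_mx 0 1.
have UE : map_mx intr U = mx2 1 k%:~R 0 1 :> 'M[R]_2.
  apply/matrixP => i j; rewrite !mxE.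
  by case: i => [[|[|//]] ?]; case: j => [[|[|//]] ?];
    rewrite /= ?mulr1 ?mulr0 ?addr0 ?add0r.
have -> : mx2 1 (s + k%:~R) 1 (t + k%:~R) = mx2 1 s 1 t *m map_mx intr U.
  by rewrite UE mx2_mul; congr mx2; ring.
apply: nba_mulr; first exact: slope_mx_unit.
rewrite unitmxE (expand_det_row _ 0) !big_ord_recl big_ord0 addr0.
by rewrite /cofactor !det_mx11 !mxE /= ?mulr0 ?mulr1 ?addr0 ?subr0.
Qed.

(** Exchanging the columns gives the rows (s, 1) and (t, 1), which the diagonal
    scaling by 1/s and 1/t normalizes. *)
Lemma nba_slope_inv (R : realType) (s t : R) :
  s != t -> s != 0 -> t != 0 -> nba_equiv (mx2 1 s 1 t) (mx2 1 s^-1 1 t^-1).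
Proof.
move=> st s0 t0; pose U : 'M[int]_2 := perm_mx (tperm 0 1).
have UE : map_mx intr U = mx2 0 1 1 0 :> 'M[R]_2.
  apply/matrixP => i j; rewrite !mxE.
  by case: i => [[|[|//]] ?]; case: j => [[|[|//]] ?]; rewrite permE.
have Mu : mx2 1 s 1 t \in unitmx by exact: slope_mx_unit.
have Uu : U \in unitmx by exact: unitmx_perm.
apply: nba_equiv_trans (nba_mulr Mu Uu) _.
have -> : mx2 1 s^-1 1 t^-1 =
          mx2 s^-1 0 0 t^-1 *m (mx2 1 s 1 t *m map_mx intr U).
  by rewrite UE !mx2_mul; congr mx2; field.
apply: nba_mull_diag; last by rewrite mulf_neq0 ?invr_neq0.
by have [_ ? _] := nba_mulr Mu Uu.
Qed.

(** * Pairs of distinct irrational slopes *)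

Lemma irrational_addz (R : realType) (k : int) (s : R) :
  irrational s -> irrational (s + k%:~R).
Proof.
move=> si [q _ qE]; apply: si; exists (q - k%:~R) => //.
by rewrite raddfB /= ratr_int qE addrK.
Qed.

Lemma irrational_inv (R : realType) (s : R) :
  irrational s -> irrational s^-1.
Proof.
by move=> si [q _ qE]; apply: si; exists q^-1; rewrite // fmorphV /= qE invrK.
Qed.

Lemma irrational_neqz (R : realType) (k : int) (s : R) :
  irrational s -> s != k%:~R.
Proof.
by move=> si; apply/eqP => sk; apply: si; exists k%:~R; rewrite // ratr_int.
Qed.

(** This is the form that irrationality of the lattice takes for the matrix with
    rows (1, s) and (1, t); it guarantees that no step below divides by zero or
    meets an integer. *)
Definition slopes (R : realType) (s t : R) : Prop :=
  [/\ irrational s, irrational t & s != t].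

Lemma slopes_shift (R : realType) (k : int) (s t : R) :
  slopes s t -> slopes (s + k%:~R) (t + k%:~R).
Proof.
move=> [si ti st]; split; [exact: irrational_addz|exact: irrational_addz|].
by rewrite (inj_eq (addIr _)).
Qed.

Lemma slopes_inv (R : realType) (s t : R) : slopes s t -> slopes s^-1 t^-1.
Proof.
move=> [si ti st]; split; [exact: irrational_inv|exact: irrational_inv|].
by rewrite (inj_eq invr_inj).
Qed.

Lemma slopes_sym (R : realType) (s t : R) : slopes s t -> slopes t s.
Proof. by move=> [si ti st]; split; rewrite // eq_sym. Qed.

(** * Reduction of a slope pair *)

Definition reducible_mx (R : realType) (A : 'M[R]_2) : Prop :=
  exists D D' : R,
    [/\ 1 < D, -1 < D' < 0 & nba_equiv A (mx2 1 (- D) 1 (- D'))].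

Lemma reducible_mx_nba (R : realType) (B A : 'M[R]_2) :
  nba_equiv A B -> reducible_mx B -> reducible_mx A.
Proof.
move=> AB [D [D' [D1 D'0 BD]]]; exists D, D'; split=> //.
exact: nba_equiv_trans AB BD.
Qed.

(** Subtracting the floor of t, which is nonnegative, keeps s below -1. *)
Lemma reducible_neg_pos_large (R : realType) (s t : R) :
  slopes s t -> s < -1 -> 0 < t -> reducible_mx (mx2 1 s 1 t).
Proof.
move=> [si ti st] s1 t0; set k := Num.floor t.
have k0 : 0 <= k by rewrite floor_ge0 ltW.
have k0R : 0 <= k%:~R :> R by rewrite ler0z.
have /andP[kt tk] := floor_itv t; rewrite -/k in kt tk.
have {}kt : k%:~R < t by rewrite lt_neqAle kt eq_sym irrational_neqz.
rewrite intrD in tk.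
exists (- (s + (- k)%:~R)), (- (t + (- k)%:~R)); rewrite !opprK.
split; last exact: nba_slope_shift.
  by rewrite intrN; lra.
by rewrite intrN; lra.
Qed.

(** Inversion preserves the signs and exchanges (-1, 0) with the half-line below
    -1. *)
Lemma reducible_neg_pos (R : realType) (s t : R) :
  slopes s t -> s < 0 -> 0 < t -> reducible_mx (mx2 1 s 1 t).
Proof.
move=> [si ti st] s0 t0.
have [s1|s1] := ltP s (-1); first exact: reducible_neg_pos_large.
have sN1 : -1 < s.
  by rewrite lt_neqAle s1 eq_sym -(intrN R 1) irrational_neqz.
have sn0 : s != 0 by rewrite lt_eqF.
have tn0 : t != 0 by rewrite gt_eqF.
apply: reducible_mx_nba (nba_slope_inv st sn0 tn0) _.
apply: reducible_neg_pos_large.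
- exact: slopes_inv.
- by rewrite -[ltRHS]invrN1 ltf_nV2 ?negrE; lra.
- by rewrite invr_gt0.
Qed.

Lemma reducible_separated (R : realType) (s t : R) (k : int) :
  slopes s t -> s < k%:~R -> k%:~R < t -> reducible_mx (mx2 1 s 1 t).
Proof.
move=> [si ti st] sk kt.
apply: reducible_mx_nba (nba_slope_shift (- k) st) _.
by apply: reducible_neg_pos; [exact: slopes_shift| |]; rewrite intrN; lra.
Qed.

(** The integer just above the smaller slope does not exceed the larger one, and
    differs from it by irrationality. *)
Lemma reducible_gap_ge1 (R : realType) (s t : R) :
  slopes s t -> 1 <= `|s - t| -> reducible_mx (mx2 1 s 1 t).
Proof.
wlog s_lt_t : s t / s < t => [hw H gap|].
  have [si ti st] := H.
  have [|ts|E] := ltgtP s t; last by rewrite E eqxx in st.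
    by move=> ?; exact: hw.
  apply: reducible_mx_nba (nba_swap_rows st) _.
  by apply: hw => //; [exact: slopes_sym|rewrite distrC].
move=> H; have [si ti st] := H.
rewrite distrC gtr0_norm ?subr_gt0 // => gap.
have /andP[ks sk] := floor_itv s.
apply: reducible_separated H sk _.
by rewrite lt_neqAle eq_sym irrational_neqz //= intrD; lra.
Qed.

(** Shift by the integer nearest to the midpoint m of s and t: the product of
    the shifted slopes is (m - k)^2 - ((s - t)/2)^2, a difference of two numbers
    in [0, 1/4]. *)
Lemma exists_shift_small_prod (R : realType) (s t : R) :
  `|s - t| < 1 -> exists k : int, `|(s + k%:~R) * (t + k%:~R)| <= 4^-1.
Proof.
move=> gap; pose m := (s + t) / 2.
exists (- Num.floor (m + 2^-1)).
have /andP[] := floor_itv (m + 2^-1).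
rewrite intrN intrD; set k := (Num.floor _)%:~R => km mk.
have gap2 : (s - t) ^+ 2 <= 1.
  by rewrite -real_normK ?num_real // expr_le1 // ltW.
have m2 : (m - k) ^+ 2 <= 4^-1 by rewrite /m in km mk *; nra.
have -> : (s - k) * (t - k) = (m - k) ^+ 2 - (s - t) ^+ 2 / 4.
  by rewrite /m; field.
have := sqr_ge0 (m - k); have := sqr_ge0 (s - t).
by rewrite ler_norml => ? ?; apply/andP; split; lra.
Qed.

Lemma slope_gap_inv (R : realType) (s t : R) :
  s != 0 -> t != 0 -> `|s * t| <= 4^-1 -> 2 * `|s - t| <= `|s^-1 - t^-1|.
Proof.
move=> s0 t0 st4.
have -> : s^-1 - t^-1 = (t - s) / (s * t) by field; rewrite s0 t0.
rewrite normrM normfV (distrC t) ler_pdivlMr ?normr_gt0 ?mulf_neq0 //.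
have := normr_ge0 (s - t); have := normr_ge0 (s * t).
by nra.
Qed.

(** The induction counts how many doublings the gap needs to reach 1; a shift
    followed by an inversion provides at least one of them. *)
Lemma reducible_gap (R : realType) (n : nat) (s t : R) :
  slopes s t -> 1 <= 2 ^+ n * `|s - t| -> reducible_mx (mx2 1 s 1 t).
Proof.
elim: n s t => [|n IHn] s t H.
  by rewrite expr0 mul1r; exact: reducible_gap_ge1.
have [gap _|gap gapn] := leP 1 `|s - t|; first exact: reducible_gap_ge1.
have [k stk] := exists_shift_small_prod gap.
have H' := slopes_shift k H; have [si ti st] := H'.
have s0 := irrational_neqz 0 si; have t0 := irrational_neqz 0 ti.
apply: reducible_mx_nba (nba_slope_shift k _) _; first by case: H.
apply: reducible_mx_nba (nba_slope_inv st s0 t0) _.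
apply: IHn; first exact: slopes_inv.
apply: le_trans gapn _; rewrite exprSr -mulrA ler_pM2l ?exprn_gt0 //.
have -> : s - t = (s + k%:~R) - (t + k%:~R) by ring.
exact: slope_gap_inv.
Qed.

Lemma reducible_slopes (R : realType) (s t : R) :
  slopes s t -> reducible_mx (mx2 1 s 1 t).
Proof.
move=> H; have [_ _ st] := H.
apply: (reducible_gap (n := Num.bound `|s - t|^-1)) => //.
rewrite -ler_pdivrMr ?normr_gt0 ?subr_eq0 // mul1r ltW //.
exact: upper_nthrootP.
Qed.

(** * From an irrational lattice to a slope pair *)

Lemma lattice_of_lincomb (R : realType) (A : 'M[R]_2) (m n : int) :
  exists p, [/\ lattice_of A p, p 0 0 = A 0 0 * m%:~R + A 0 1 * n%:~R
                              & p 1 0 = A 1 0 * m%:~R + A 1 1 * n%:~R].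
Proof.
exists (A *m map_mx intr (\col_i [:: m; n]`_i)).
split; first by exists (\col_i [:: m; n]`_i).
  by rewrite !mxE !big_ord_recl big_ord0 addr0 !mxE /=;
     congr (_ + A _ _ * _); apply/val_inj.
by rewrite !mxE !big_ord_recl big_ord0 addr0 !mxE /=;
   congr (_ + A _ _ * _); apply/val_inj.
Qed.

(** The combination of the columns with coefficients m and n is a lattice point
    distinct from the origin because the columns are independent; irrationality
    is applied to these two points. *)
Lemma irrational_mx_coord (R : realType) (A : 'M[R]_2) (m n : int) :
  irrational_mx A -> (m, n) != (0, 0) ->
  A 0 0 * m%:~R + A 0 1 * n%:~R != 0 /\ A 1 0 * m%:~R + A 1 1 * n%:~R != 0.
Proof.
move=> [Au irr] mn0.
have [p [Lp p0 p1]] := lattice_of_lincomb A m n.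
have L0 : lattice_of A 0 by exists 0; rewrite map_mx0 mulmx0.
have [pE|/eqP pn0] := eqVneq p 0; last first.
  have [] := irr _ _ Lp L0 pn0; rewrite !mxE p0 p1.
  by split; apply/eqP.
exfalso; rewrite pE !mxE in p0 p1.
rewrite [A]mx2_eta mx2_unit in Au; case/negP: mn0.
have mE : (A 0 0 * A 1 1 - A 0 1 * A 1 0) * m%:~R = 0.
  transitivity (A 1 1 * (A 0 0 * m%:~R + A 0 1 * n%:~R)
                - A 0 1 * (A 1 0 * m%:~R + A 1 1 * n%:~R)); first by ring.
  by rewrite -p0 -p1 !mulr0 subr0.
have nE : (A 0 0 * A 1 1 - A 0 1 * A 1 0) * n%:~R = 0.
  transitivity (A 0 0 * (A 1 0 * m%:~R + A 1 1 * n%:~R)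
                - A 1 0 * (A 0 0 * m%:~R + A 0 1 * n%:~R)); first by ring.
  by rewrite -p0 -p1 !mulr0 subr0.
move/eqP: mE; rewrite mulf_eq0 (negPf Au) intr_eq0 /= => /eqP ->.
by move/eqP: nE; rewrite mulf_eq0 (negPf Au) intr_eq0 /= => /eqP ->.
Qed.

(** Were y / x = p / q, the integers m = p and n = -q would give a relation. *)
Lemma irrational_ratio (R : realType) (x y : R) :
  x != 0 ->
  (forall m n : int, (m, n) != (0, 0) -> x * m%:~R + y * n%:~R != 0) ->
  irrational (y / x).
Proof.
move=> x0 free [q _ qE].
suff: x * (numq q)%:~R + y * (- denq q)%:~R == 0.
  by apply/negP/free; rewrite xpair_eqE oppr_eq0 denq_eq0 andbF.
apply/eqP; have -> : y = ratr q * x by rewrite qE divfK.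
rewrite /ratr intrN; field.
by rewrite intr_eq0 denq_eq0.
Qed.

Lemma irrational_mx_slopes (R : realType) (A : 'M[R]_2) :
  irrational_mx A -> exists s t, slopes s t /\ nba_equiv A (mx2 1 s 1 t).
Proof.
move=> Airr; have free m n := @irrational_mx_coord R A m n Airr.
have [Au _] := Airr.
have [] := free 1 0 isT; rewrite !mulr1 !mulr0 !addr0 => x0 y0.
exists (A 0 1 / A 0 0), (A 1 1 / A 1 0); split.
  split.
  - by apply: irrational_ratio => // m n /free[].
  - by apply: irrational_ratio => // m n /free[].
  rewrite [A]mx2_eta mx2_unit in Au; rewrite eqr_div // -subr_eq0.
  by apply: contraNneq Au => E; apply/eqP; lra.
have -> : mx2 1 (A 0 1 / A 0 0) 1 (A 1 1 / A 1 0) =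
          mx2 (A 0 0)^-1 0 0 (A 1 0)^-1 *m A.
  by rewrite [X in _ = _ *m X]mx2_eta mx2_mul; congr mx2; field.
by apply: nba_mull_diag => //; rewrite mulf_neq0 ?invr_neq0.
Qed.

(** * The maximal empty box *)

Lemma open_box_subset (R : realType) (a b c d a' b' c' d' : R) :
  a < b -> c < d -> (open_box a b c d `<=` open_box a' b' c' d')%classic ->
  [/\ a' <= a, b <= b', c' <= c & d <= d'].
Proof.
move=> ab cd sub.
have inB x y : a < x < b -> c < y < d -> a' < x < b' /\ c' < y < d'.
  move=> xP yP; have := sub (\col_i [:: x; y]`_i).
  by rewrite /open_box /= !mxE /=; apply.
have xm : a < (a + b) / 2 < b by lra.
have ym : c < (c + d) / 2 < d by lra.
(* If a < a', the midpoint of a and min(a', b) lies between a and b but not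
   above a'; the other sides are similar. *)
split; rewrite leNgt; apply/negP => lt.
- have [] := inB ((a + Num.min a' b) / 2) _ _ ym;
    by rewrite minEle; case: ifP; lra.
- have [] := inB ((b + Num.max b' a) / 2) _ _ ym;
    by rewrite maxEle; case: ifP; lra.
- have [] := inB _ ((c + Num.min c' d) / 2) xm;
    by rewrite minEle; case: ifP; lra.
- have [] := inB _ ((d + Num.max d' c) / 2) xm;
    by rewrite maxEle; case: ifP; lra.
Qed.

Lemma B0_empty (R : realType) (D D' : R) : 1 < D -> -1 < D' < 0 ->
  empty_box (lattice_of (mx2 1 (- D) 1 (- D'))) (open_box (- D) 1 0 (1 - D')).
Proof.
move=> D1 D'0; split.
  by exists (- D), 1, 0, (1 - D'); split=> //; lra.
rewrite -subset0 => _ [[z ->]].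
rewrite /open_box /= !mxE !big_ord_recl !big_ord0 !mxE /=.
move: (z _ _) (z _ _) => n m; rewrite !addr0 !mul1r => -[xP yP].
have [n1|n0] := leP 1 n.
  have n1R : 1 <= n%:~R :> R by rewrite (ler_int R 1).
  have : n - 1 < m by rewrite -(ltr_int R) intrB; nra.
  rewrite ltrBlDr ltzD1 -(ler_int R) => nmR.
  by nra.
have n0R : n%:~R <= 0 :> R by rewrite (ler_int R _ 0) -ltzD1.
have : m < n + 1 by rewrite -(ltr_int R) intrD; nra.
rewrite ltzD1 -(ler_int R) => mnR.
by nra.
Qed.

(** The sides carry the lattice points (-D, -D'), (1, 1), (0, 0) and
    (1 - D, 1 - D'), so that a larger box in which one side has moved outward
    contains one of them. *)
Lemma B0_maximal (R : realType) (D D' : R) : 1 < D -> -1 < D' < 0 ->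
  maximal_empty_box (lattice_of (mx2 1 (- D) 1 (- D')))
                    (open_box (- D) 1 0 (1 - D')).
Proof.
move=> D1 D'0; split; first exact: B0_empty.
move=> _ [[a [b [c [d [ab cd ->]]]]] emp] [sub]; apply.
have wD : - D < 1 by lra.
have hD : 0 < 1 - D' by lra.
have [aD b1 c0 dD] := open_box_subset wD hD sub.
have miss (m n : int) :
    ~ (a < m%:~R - D * n%:~R < b /\ c < m%:~R - D' * n%:~R < d).
  have [p [Lp]] := lattice_of_lincomb (mx2 1 (- D) 1 (- D')) m n.
  rewrite !mxE /= !mul1r !mulNr => <- <- Bp.
  by rewrite -[False]/(set0 p) -emp.
have onleft := miss 0 1.
have onright := miss 1 0.
have onbottom := miss 0 0.
have ontop := miss 1 1.
rewrite !mulr1 !mulr0 ?subr0 ?sub0r in onleft onright onbottom ontop.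
have aE : a = - D.
  by apply/eqP; rewrite eq_le aD leNgt; apply/negP => ?;
     apply: onleft; split; lra.
have bE : b = 1.
  by apply/eqP; rewrite eq_le b1 andbT leNgt; apply/negP => ?;
     apply: onright; split; lra.
have cE : c = 0.
  by apply/eqP; rewrite eq_le c0 leNgt; apply/negP => ?;
     apply: onbottom; split; lra.
have dE : d = 1 - D'.
  by apply/eqP; rewrite eq_le dD andbT leNgt; apply/negP => ?;
     apply: ontop; split; lra.
by rewrite aE bE cE dE.
Qed.

Theorem proposition2p9 (R : realType) :
  (forall A : 'M[R]_2, irrational_mx A ->
     exists D D' : R,
       [/\ 1 < D, -1 < D' < 0 & nba_equiv A (mx2 1 (- D) 1 (- D'))])
  /\
  (forall D D' : R, 1 < D -> -1 < D' < 0 ->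
     maximal_empty_box (lattice_of (mx2 1 (- D) 1 (- D')))
                       (open_box (- D) 1 0 (1 - D'))).
Proof.
split=> [A /irrational_mx_slopes[s [t [st Ast]]]|]; last exact: B0_maximal.
exact: reducible_mx_nba Ast (reducible_slopes st).
Qed.
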